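(* Suppose that $\mathcal Q$ is a convex subset of $\mathcal X'$ satisfying the following assumption: $\mathcal Q$ is a non-empty, closed, convex subset of $\mathcal X'$ and there exists a closed subspace $\mathcal H_{\mathcal Q}\subset\mathcal X$ such that $\mathcal Q=\mathcal H_{\mathcal Q}^\perp\cap\partial B'_+$. Let $\mathfrak L$ be a strongly closed subspace of $\mathcal X''$ containing $\mathbf e$, and let $\mathfrak K\subset\mathfrak L$ be a cone satisfying $$\mathfrak z\in\mathfrak K\ \text{ and }\ \mathfrak n\in\mathfrak L\cap\mathcal X''_-\ \Rightarrow\ \mathfrak z+\mathfrak n\in\mathfrak K .$$ Then the duality $$\mathbf P(\mathfrak a;\mathcal Q)=\mathbf D(\mathfrak a;\mathfrak K)\qquad\text{for all }\mathfrak a\in\mathfrak L$$ holds if and only if the strong closure $\overline{\mathfrak K}$ of $\mathfrak K$ is equal to $\mathfrak K_{\mathcal Q}\cap\mathfrak L$. Moreover, there is dual attainment in $\overline{\mathfrak K}$. Namely, for every $\mathfrak a\in\mathfrak L$ there exists $\mathfrak z_{\mathfrak a}\in\overline{\mathfrak K}$ satisfying $$\mathbf D(\mathfrak a;\mathfrak K)\,\mathbf e+\mathfrak z_{\mathfrak a}=\mathfrak a .$$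
   Context: $\mathcal X$ is a real Banach lattice with an order unit $\mathbf e\in\mathcal X_+$ and norm $\|f\|_{\mathcal X}=\inf\{c\in\mathbb R: -c\,\mathbf e\le f\le c\,\mathbf e\}$. $\mathcal X'$ and $\mathcal X''$ are the topological dual and bidual. $\mathcal X'$ carries the dual order: $\eta\in\mathcal X'_+$ iff $\eta(f)\ge 0$ for all $0\le f\in\mathcal X$. $\mathcal X''$ carries the order induced by $\mathcal X'$, and $\mathcal X''_-$ is the set of $\mathfrak n\in\mathcal X''$ with $\mathfrak n(\eta)\le 0$ for all $\eta\in\mathcal X'_+$. The same symbol $\mathbf e$ is used for the image of the order unit in $\mathcal X''$ under the canonical embedding, i.e. for the functional $\eta\mapsto\eta(\mathbf e)$ on $\mathcal X'$. $\partial B'_+=\{\eta\in\mathcal X'_+:\eta(\mathbf e)=1\}$ is the positive part of the unit sphere of $\mathcal X'$. $\mathcal H^\perp=\{\eta\in\mathcal X':\eta(h)=0\ \forall h\in\mathcal H\}$ is the annihilator of $\mathcal H\subset\mathcal X$. ''Strong'' refers to the norm topology of $\mathcal X''$. For $\mathfrak a\in\mathcal X''$: $$\mathbf P(\mathfrak a;\mathcal Q)=\sup_{\eta\in\mathcal Q}\mathfrak a(\eta),\qquad \mathbf D(\mathfrak a;\mathfrak K)=\inf\{c\in\mathbb R:\exists\,\mathfrak z\in\mathfrak K\text{ such that } c\,\mathbf e+\mathfrak z=\mathfrak a\}\quad(\inf\emptyset=+\infty),$$ $$\mathfrak K_{\mathcal Q}=\{\mathfrak z\in\mathcal X'':\mathfrak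 z(\eta)\le 0\ \ \forall\eta\in\mathcal Q\}.$$ *)

(* Defs.v *)
From HB Require Import structures.
From mathcomp Require Import all_boot all_order all_algebra.
From mathcomp Require Import mathcomp_extra boolp classical_sets functions.
From mathcomp Require Import reals ereal convex topology normedtype.

Set Implicit Arguments.
Unset Strict Implicit.
Unset Printing Implicit Defensive.

Import Order.TTheory GRing.Theory Num.Theory.
Import numFieldNormedType.Exports.

Local Open Scope classical_set_scope.
Local Open Scope ring_scope.

(* The order is a field [bl_le] rather than an [Order.Lattice] structure:
   [Num.RealDomain] already inherits from both lattices and Z-modules, which
   prevents their join from being declared downstream. *)
HB.mixin Record isBanachLattice (R : realType) X
    & CompleteNormedModule R X := {
  bl_le : rel X ;
  bl_join : X -> X -> X ;
  bl_meet : X -> X -> X ;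
  bl_le_refl : reflexive bl_le ;
  bl_le_anti : antisymmetric bl_le ;
  bl_le_trans : transitive bl_le ;
  bl_joinP : forall x y z, bl_le (bl_join x y) z = bl_le x z && bl_le y z ;
  bl_meetP : forall x y z, bl_le z (bl_meet x y) = bl_le z x && bl_le z y ;
  bl_leD2r : forall z x y, bl_le x y -> bl_le (x + z) (y + z) ;
  bl_leZ : forall (c : R) x y, 0 <= c -> bl_le x y -> bl_le (c *: x) (c *: y) ;
  bl_le_norm : forall x y,
    bl_le (bl_join x (- x)) (bl_join y (- y)) -> `|x| <= `|y|
}.

#[short(type="banachLatticeType")]
HB.structure Definition BanachLattice (R : realType) :=
  {X of CompleteNormedModule R X & isBanachLattice R X}.

Notation "x ≼ y" := (bl_le x y) (at level 70, no associativity) : ring_scope.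

Section dual.
Context {R : realType} {V : normedModType R}.

Definition lin_cont : {pred V -> R^o} :=
  fun f => `[< linear f /\ continuous f >].

Lemma lin_cont_submod : submod_closed lin_cont.
Proof.
split.
  apply/asboolP; split => [a u v|x] /=; last exact: cvg_cst.
  by rewrite [RHS]addr0 [RHS]scaler0.
move=> a f g /asboolP[lf cf] /asboolP[lg cg]; apply/asboolP; split.
  move=> b u v; have E w : (a *: f + g) w = a *: f w + g w by [].
  rewrite !E lf lg !scalerDr !scalerA (mulrC a b) -!addrA; congr (_ + _).
  by rewrite addrCA.
move=> x; apply: cvgD; last exact: cg.
by apply: cvgZr; exact: cf.
Qed.

HB.instance Definition _ :=
  GRing.isSubmodClosed.Build R (V -> R^o) lin_cont lin_cont_submod.

End dual.

Record dual (R : realType) (V : normedModType R) := Dual {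
  dual_fun :> V -> R^o ;
  dual_lin_cont : dual_fun \in lin_cont }.

Section dual_normed.
Context {R : realType} {V : normedModType R}.
Implicit Types (u v : dual V) (f g : V).

HB.instance Definition _ := [isSub for @dual_fun R V].
HB.instance Definition _ := [Choice of dual V by <:].
HB.instance Definition _ := [SubChoice_isSubLmodule of dual V by <:].

Lemma dual_linear u : linear u.
Proof. by have /asboolP[] := dual_lin_cont u. Qed.

HB.instance Definition _ u :=
  GRing.isLinear.Build R V R^o *:%R (dual_fun u) (dual_linear u).

Lemma dual_continuous u : continuous u.
Proof. by have /asboolP[] := dual_lin_cont u. Qed.

Lemma dualDE u v f : (u + v) f = u f + v f. Proof. by []. Qed.
Lemma dualZE (a : R) u f : (a *: u) f = a * u f. Proof. by []. Qed.
Lemma dual0E f : (0 : dual V) f = 0. Proof. by []. Qed.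

Definition dual_norm u : R := sup [set `|u f| | f in [set f | `|f| <= 1]].

Lemma dual_norm_has_sup u : has_sup [set `|u f| | f in [set f | `|f| <= 1]].
Proof.
split; first by exists `|u 0|, 0 => //=; rewrite normr0.
have /linear_bounded_continuous/bounded_funP/(_ 1)[M uM] := @dual_continuous u.
by exists M => _ [f /= f1 <-]; exact: uM.
Qed.

Lemma dual_norm_ub u f : `|f| <= 1 -> `|u f| <= dual_norm u.
Proof. by move=> f1; apply: sup_ubound; [case: (dual_norm_has_sup u)|exists f]. Qed.

Lemma dual_norm_le u M : (forall f, `|f| <= 1 -> `|u f| <= M) -> dual_norm u <= M.
Proof.
move=> uM; apply: ge_sup; first by case: (dual_norm_has_sup u).
by move=> _ [f /= f1 <-]; exact: uM.
Qed.

Lemma dual_norm_ge0 u : 0 <= dual_norm u.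
Proof. by apply: le_trans (@dual_norm_ub u 0 _); rewrite ?normr0. Qed.

Lemma le_dual_norm u f : `|u f| <= dual_norm u * `|f|.
Proof.
have [->|f0] := eqVneq f 0; first by rewrite linear0 !normr0 mulr0.
have nf : 0 < `|f| by rewrite normr_gt0.
rewrite -ler_pdivrMr// mulrC -[X in X * _]gtr0_norm ?invr_gt0// -normrM.
have -> : `|f|^-1 * u f = u (`|f|^-1 *: f) by rewrite linearZ.
by apply: dual_norm_ub; rewrite normrZ normfV normr_id mulVf ?gt_eqF.
Qed.

Lemma dual_normD u v : dual_norm (u + v) <= dual_norm u + dual_norm v.
Proof.
apply: dual_norm_le => f f1; rewrite dualDE (le_trans (ler_normD _ _))//.
by rewrite lerD// dual_norm_ub.
Qed.

Lemma dual_normZ (a : R) u : dual_norm (a *: u) = `|a| * dual_norm u.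
Proof.
have le b v : dual_norm (b *: v) <= `|b| * dual_norm v.
  apply: dual_norm_le => f f1; rewrite dualZE normrM.
  by rewrite ler_wpM2l// dual_norm_ub.
apply/eqP; rewrite eq_le le/=; have [->|a0] := eqVneq a 0.
  by rewrite normr0 mul0r dual_norm_ge0.
rewrite -ler_pdivlMl ?normr_gt0// -normfV.
by rewrite -{1}[u](@scalerK _ _ a _)// ?unitfE// le.
Qed.

Lemma dual_norm0_eq0 u : dual_norm u = 0 -> u = 0.
Proof.
move=> u0; apply/val_inj/funext => f /=; apply/eqP; rewrite -normr_le0.
by rewrite (le_trans (le_dual_norm u f))// u0 mul0r.
Qed.

HB.instance Definition _ :=
  Lmodule_isNormed.Build R (dual V) dual_normD dual_normZ dual_norm0_eq0.

End dual_normed.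

Section evaluation.
Context {R : realType} {V : normedModType R}.

Lemma embed_lin_cont (f : V) : (fun u : dual V => u f : R^o) \in lin_cont.
Proof.
apply/asboolP.
have lin : linear (fun u : dual V => u f : R^o) by [].
split => //.
pose l : {linear dual V -> R^o} := HB.pack (fun u : dual V => u f : R^o)
  (GRing.isLinear.Build _ _ _ _ _ lin).
apply: (@bounded_linear_continuous R _ _ l); apply/bounded_funP => r.
exists (r * `|f|) => u ur; rewrite (le_trans (le_dual_norm u f))//.
by rewrite ler_wpM2r.
Qed.

Definition embed (f : V) : dual (dual V) := Dual (embed_lin_cont f).

End evaluation.

Section order_unit.
Context {R : realType} {X : banachLatticeType R}.
Implicit Types (e : X) (H : set X) (Q : set (dual X)).
Implicit Types (K : set (dual (dual X))) (a : dual (dual X)).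

Definition order_unit e :=
  0 ≼ e /\ forall f : X, exists c : R, - (c *: e) ≼ f /\ f ≼ c *: e.

(* [inf] is a genuine infimum here, except when [e = 0], i.e. when [X] is
   trivial; then [dual_sphere_pos e] below is empty. *)
Definition order_unit_norm e :=
  forall f : X, `|f| = inf [set c : R | - (c *: e) ≼ f /\ f ≼ c *: e].

Definition dual_pos : set (dual X) :=
  [set eta | forall f : X, 0 ≼ f -> 0 <= eta f].

Definition bidual_neg : set (dual (dual X)) :=
  [set n | forall eta, dual_pos eta -> n eta <= 0].

Definition dual_sphere_pos e : set (dual X) :=
  [set eta | dual_pos eta /\ eta e = 1].

Definition annihilator H : set (dual X) :=
  [set eta | forall h, H h -> eta h = 0].

Definition polar_cone Q : set (dual (dual X)) :=
  [set z | forall eta, Q eta -> z eta <= 0].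

Definition primal_value a Q : \bar R := ereal_sup [set (a eta)%:E | eta in Q].

Definition dual_value e a K : \bar R :=
  ereal_inf [set c%:E | c in [set c : R | exists2 z, K z & c *: embed e + z = a]].

End order_unit.

Definition closed_subspace {R : realType} {V : normedModType R} (L : set V) :=
  closed L /\ submod_closed (mem L).

(* A cone is closed under positive scaling; neither convexity nor [K 0] is
   part of the notion. *)
Definition cone {R : realType} {V : lmodType R} (K : set V) :=
  forall (t : R) z, 0 < t -> K z -> K (t *: z).

Definition admissible {R : realType} {X : banachLatticeType R} (e : X)
    (Q : set (dual X)) :=
  [/\ Q !=set0, closed Q, convex_set Q &
      exists2 H : set X, closed_subspace H &
        Q = annihilator H `&` dual_sphere_pos e].

(* Main.v *)
Require Import Defs.
From mathcomp Require Import all_boot all_order all_algebra.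
From mathcomp Require Import mathcomp_extra boolp classical_sets functions.
From mathcomp Require Import reals ereal convex topology normedtype.

Import Order.TTheory GRing.Theory Num.Theory.
Import numFieldNormedType.Exports.

Set Implicit Arguments.
Unset Strict Implicit.
Unset Printing Implicit Defensive.

Local Open Scope classical_set_scope.
Local Open Scope ring_scope.

(** The two values are compared through their real sublevel sets.  As every
    [eta] in [Q] takes the value 1 at the order unit, [P(a; Q) <= c] means that
    [a - c e] lies in the polar cone of [Q] ([primal_value_leP]).  On the other
    side, [D(a; K) <= c] means that [a - c e] lies in the strong closure of [K]
    ([dual_value_leP]).  Hence [P = D] on [L] exactly when the polar cone and
    the closure of [K] have the same elements in [L], and attainment in the
    closure is the case [c = D(a; K)].

    The description of the sublevel sets of [D] rests on one property of the
    order unit: [v <= |v| e] for every [v] in the bidual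
    ([bidual_neg_sub_norm]), that is, the negative cone contains a ball around
    [- e].  Since [K] absorbs the negative elements of [L], a point of its
    closure enters [K] as soon as it is shifted by an arbitrarily small negative
    multiple of [e], and such shifts characterize the closure
    ([closure_shiftP]). *)

Lemma lee_fin_ub (R : realType) (x y : \bar R) :
  (forall c : R, (y <= c%:E)%E -> (x <= c%:E)%E) -> (x <= y)%E.
Proof.
case: y => [y||] xy; [exact: xy|exact: leey|].
case: x xy => [x||] xy //.
- have := xy (x - 1) (leNye _).
  by rewrite lee_fin leNgt ltrBlDr ltrDl ltr01.
- by have := xy 0 (leNye _).
Qed.

Lemma closed_subspaceBZ (R : realType) (V : normedModType R) (L : set V)
    (c : R) (u v : V) :
  closed_subspace L -> L u -> L v -> L (u - c *: v).
Proof.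
move=> [_ [_ Lc]] Lu Lv; rewrite addrC -scaleNr -(in_setE L).
by apply: Lc; rewrite in_setE.
Qed.

(** * The order unit and the negative cone of the bidual *)

Section order_unit.
Context {R : realType} {X : banachLatticeType R} (e : X).
Hypotheses (e_unit : order_unit e) (e_norm : order_unit_norm e).

Lemma dual_pos_le (eta : dual X) (f g : X) :
  dual_pos eta -> f ≼ g -> eta f <= eta g.
Proof.
move=> pos fg; rewrite -subr_ge0 -linearB; apply: pos.
by have := bl_leD2r (- f) f g fg; rewrite subrr.
Qed.

(** A positive functional is bounded by its value at the order unit, because
    the unit ball of [X] lies in the order interval from [- c e] to [c e] for
    every [c > 1]. *)
Lemma dual_pos_norm_le (eta : dual X) : dual_pos eta -> `|eta| <= eta e.
Proof.
move=> pos; have [e0 e_ub] := e_unit.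
have ee0 : 0 <= eta e by exact: pos.
apply: dual_norm_le => f f1; apply/ler_addgt0Pr => d d0.
(* [r] is small enough for [r * eta e <= d], even when [eta e = 0] *)
pose r := d / (eta e + 1).
have r0 : 0 < r by rewrite divr_gt0 // ltr_wpDl.
have [c [cf fc] cr] : exists2 c : R, - (c *: e) ≼ f /\ f ≼ c *: e & c < 1 + r.
  apply: contrapT => /forall2NP noc.
  have : `|f| < 1 + r by rewrite (le_lt_trans f1) // ltrDl.
  apply/negP; rewrite -leNgt e_norm; apply: lb_le_inf.
    by have [c fc] := e_ub f; exists c.
  by move=> c fc; rewrite leNgt; apply/negP; case: (noc c).
apply: (@le_trans _ _ (c * eta e)).
  rewrite ler_norml; apply/andP; split.
    by have := dual_pos_le pos cf; rewrite linearN linearZ.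
  by have := dual_pos_le pos fc; rewrite linearZ.
apply: (@le_trans _ _ ((1 + r) * eta e)); first by rewrite ler_wpM2r // ltW.
rewrite mulrDl mul1r lerD2l /r mulrAC ler_pdivrMr ?ltr_wpDl //.
by rewrite ler_pM2l // lerDl.
Qed.

(** This is [v <= |v| e]: for positive [eta] one has
    [v eta <= |v| |eta| <= |v| eta e].  Stated with a bound [c] it says that
    the negative cone contains the ball of radius [c] around [- c e]. *)
Lemma bidual_neg_sub_norm (v : dual (dual X)) (c : R) :
  `|v| <= c -> bidual_neg (v - c *: embed e).
Proof.
move=> vc eta pos; rewrite /= subr_le0.
have c0 : 0 <= c := le_trans (normr_ge0 v) vc.
apply: (le_trans (ler_norm _)); apply: (le_trans (le_dual_norm v eta)).
apply: ler_pM => //; first exact: dual_norm_ge0.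
exact: dual_pos_norm_le.
Qed.

(** * Sublevel sets of the primal value *)

Section primal_value.
Context (Q : set (dual X)).
Hypothesis Q_sphere : Q `<=` dual_sphere_pos e.

Lemma primal_value_leP (a : dual (dual X)) (c : R) :
  (primal_value a Q <= c%:E)%E <-> polar_cone Q (a - c *: embed e).
Proof.
have E eta : Q eta -> (a - c *: embed e) eta = a eta - c.
  move=> /Q_sphere[_ e1]; change (a eta - c * eta e = a eta - c).
  by rewrite e1 mulr1.
split=> [Pc eta Qeta|neg].
  rewrite E // subr_le0 -lee_fin; apply: le_trans Pc.
  by apply: ereal_sup_ubound; exists eta.
apply: ge_ereal_sup => _ [eta Qeta <-].
by rewrite lee_fin -subr_le0 -E //; exact: neg.
Qed.

Lemma primal_value_fin_num (a : dual (dual X)) :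
  Q !=set0 -> primal_value a Q \is a fin_num.
Proof.
move=> [eta Qeta]; rewrite fin_numElt; apply/andP; split.
  apply: lt_le_trans (ltNyr (a eta)) _.
  by apply: ereal_sup_ubound; exists eta.
apply: le_lt_trans _ (ltry `|a|); apply/primal_value_leP => th Qth.
by apply: bidual_neg_sub_norm => //; have [] := Q_sphere Qth.
Qed.

End primal_value.

(** * Sublevel sets of the dual value *)

Section dual_value.
Context (L K : set (dual (dual X))).
Hypotheses (L_sub : closed_subspace L) (L_e : L (embed e)).
Hypotheses (K_L : K `<=` L).
Hypothesis K_neg : forall z n, K z -> (L `&` bidual_neg) n -> K (z + n).

Lemma closure_sub : closure K `<=` L.
Proof.
have [L_closed _] := L_sub.
rewrite [X in _ `<=` X](proj1 (closure_id L) L_closed).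
exact: closure_subset.
Qed.

(** A point of the closure differs from a point of [K] by less than [d e], so
    that after subtracting [d e] the difference is negative and absorbed by
    [K]. *)
Lemma closure_shiftP (z : dual (dual X)) :
  closure K z <-> forall d : R, 0 < d -> K (z - d *: embed e).
Proof.
split=> [cKz d d0|shift].
  have [k [Kk /= zk]] := cKz _ (nbhsx_ballx z d d0).
  rewrite -ball_normE /= in zk.
  rewrite -[z](subrK k) (addrC (z - k)) -addrA; apply: K_neg => //; split.
    apply: closed_subspaceBZ => //; rewrite -[k]scale1r.
    by apply: closed_subspaceBZ => //; [exact: closure_sub|exact: K_L].
  by apply: bidual_neg_sub_norm; exact: ltW.
move=> B /nbhs_ballP[r /= r0 rB].
have e1 : 0 < `|embed e| + 1 by rewrite ltr_wpDl.
pose d := r / (`|embed e| + 1).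
have d0 : 0 < d by rewrite divr_gt0.
exists (z - d *: embed e); split; first exact: shift.
apply: rB; rewrite -ball_normE /= opprB addrC subrK normrZ gtr0_norm //.
by rewrite /d mulrAC ltr_pdivrMr // ltr_pM2l // ltrDl.
Qed.

(** The infimum defining [D] need not be attained in [K].  A value [<= c] only
    gives [a - (c + d) e] in [K] for all [d > 0], since [K] is stable under
    subtracting positive multiples of [e]; by [closure_shiftP] this is membership of
    [a - c e] in the closure. *)
Lemma dual_value_leP (a : dual (dual X)) (c : R) :
  (dual_value e a K <= c%:E)%E <-> closure K (a - c *: embed e).
Proof.
split=> [Dc|/closure_shiftP shift].
  apply/closure_shiftP => d d0.
  have : (dual_value e a K < (c + d)%:E)%E.
    by rewrite (le_lt_trans Dc) // lte_fin ltrDl.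
  move=> /ereal_inf_lt[_ [b [z Kz za] <-]]; rewrite lte_fin => bcd.
  have -> : a - c *: embed e - d *: embed e = z + (0 - (c + d - b) *: embed e).
    rewrite -za -addrA -opprD -scalerDl sub0r scalerBl opprB addrA.
    by rewrite (addrC z).
  apply: K_neg => //; split.
    apply: closed_subspaceBZ => //.
    by rewrite -(subrr (embed e)) -[X in _ - X]scale1r; exact: closed_subspaceBZ.
  by apply: bidual_neg_sub_norm; rewrite normr0 subr_ge0 ltW.
apply/lee_addgt0Pr => d d0; rewrite -EFinD; apply: ereal_inf_lbound.
exists (c + d) => //; exists (a - c *: embed e - d *: embed e); first exact: shift.
by rewrite -addrA -opprD -scalerDl [LHS]addrC subrK.
Qed.

End dual_value.

End order_unit.

(** * The duality *)

Theorem theorem4p1 (R : realType) (X : banachLatticeType R) (e : X)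
    (Q : set (dual X)) (L K : set (dual (dual X)))
    (e_unit : order_unit e) (e_norm : order_unit_norm e)
    (Q_adm : admissible e Q)
    (L_sub : closed_subspace L) (L_e : L (embed e))
    (K_L : K `<=` L) (K_cone : cone K)
    (K_neg : forall z n, K z -> (L `&` bidual_neg) n -> K (z + n)) :
  ((forall a, L a -> primal_value a Q = dual_value e a K) <->
     closure K = polar_cone Q `&` L)
  /\ ((forall a, L a -> primal_value a Q = dual_value e a K) ->
       forall a, L a -> dual_value e a K \is a fin_num)
  /\ (forall a, L a -> dual_value e a K \is a fin_num ->
       exists2 z, closure K z & fine (dual_value e a K) *: embed e + z = a).
Proof.
have [Q0 _ _ [H _ QE]] := Q_adm.
have Q_sphere : Q `<=` dual_sphere_pos e by rewrite QE => eta [].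
have PP := primal_value_leP Q_sphere.
have DP := dual_value_leP e_unit e_norm L_sub L_e K_L K_neg.
have cKL := closure_sub L_sub K_L.
split; [split=> [PD|KE]|split=> [PD a La|a La Dfin]].
- have shift0 (z : dual (dual X)) : z - 0 *: embed e = z.
    by rewrite scale0r subr0.
  apply/seteqP; split=> [z Kz|z [zQ Lz]].
    split; last exact: cKL.
    by rewrite -(shift0 z); apply/PP; rewrite PD ?DP ?shift0 //; exact: cKL.
  by rewrite -(shift0 z); apply/DP; rewrite -PD // PP shift0.
- move=> a La; apply/eqP; rewrite eq_le; apply/andP.
  split; apply: lee_fin_ub => c.
    by move=> /DP; rewrite KE => -[? _]; apply/PP.
  by move=> /PP ?; apply/DP; rewrite KE; split=> //; exact: closed_subspaceBZ.
- by rewrite -PD //; exact: (primal_value_fin_num e_unit e_norm).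
- exists (a - fine (dual_value e a K) *: embed e); last by rewrite addrC subrK.
  by apply/DP; rewrite fineK.
Qed.
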